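(* Let $X$ be a completely regular space which is locally null with respect to an ideal $\mathscr{I}$ of $(\mathrm{Coz}(X),\subseteq)$. Then $C^{\mathscr I}_0(X)$ is a Banach algebra isometrically isomorphic to $C_0(Y)$ for some unique (up to homeomorphism) locally compact Hausdorff space $Y$, namely $Y=\lambda_{\mathscr I} X$. Furthermore: (1) $X$ is dense in $Y$ (in particular $X\subseteq Y$). (2) $C^{\mathscr I}_0(X)$ is of empty hull. (3) $C^{\mathscr I}_{00}(X)$ is dense in $C^{\mathscr I}_0(X)$. (4) $C^{\mathscr I}_0(X)$ is unital if and only if $\mathscr{I}$ is non-proper if and only if $Y$ is compact.
   Context: A space is a topological space; completely regular spaces are taken to be Hausdorff, so that the Stone–Čech compactification $\beta X$ exists and contains $X$ as a dense subspace. $C_b(X)$ is the normed algebra of continuous bounded $f:X\to\mathbb{R}$ with pointwise operations and the supremum norm. For $f\in C_b(X)$: $\mathrm{z}(f)=f^{-1}(0)$, $\mathrm{coz}(f)=X\setminus\mathrm{z}(f)$, $\mathrm{supp}(f)=\mathrm{cl}_X\mathrm{coz}(f)$. $\mathrm{Coz}(X)$ is the set of all cozero-sets $\mathrm{coz}(f)$ of continuous real-valued functions on $X$; ordered by inclusion it is an upper semi-lattice with $C\vee D=C\cup D$. $C_0(Y)$ is the set of $f\in C_b(Y)$ vanishing at infinity, i.e. with $|f|^{-1}([1/n,\infty))$ compact for each positive integer $n$. ''Isometrically isomorphic'' means by an isometric algebra isomorphism. An ideal $\mathscr{I}$ in $(\mathrm{Coz}(X),\subseteq)$ is a non-empty subset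 of $\mathrm{Coz}(X)$ such that $A\cup B\in\mathscr{I}$ whenever $A,B\in\mathscr{I}$, and $T\in\mathscr{I}$ whenever $T\in\mathrm{Coz}(X)$ and $T\subseteq A$ for some $A\in\mathscr{I}$. Elements of $\mathscr{I}$ are called null; $\mathscr{I}$ is proper if $X$ is not null, and non-proper if $X\in\mathscr{I}$. A neighborhood of a set $A$ in $X$ is a set $U\subseteq X$ with $A\subseteq\mathrm{int}_XU$. $X$ is locally null (with respect to $\mathscr{I}$) if every point of $X$ has a null neighborhood in $X$. $C^{\mathscr I}_{00}(X)=\{f\in C_b(X):\mathrm{supp}(f)\text{ has a null neighborhood in }X\}$. $C^{\mathscr I}_0(X)=\{f\in C_b(X):|f|^{-1}([1/n,\infty))\text{ has a null neighborhood in }X\text{ for each positive integer }n\}$. $\lambda_{\mathscr I} X=\bigcup\{\mathrm{int}_{\beta X}\mathrm{cl}_{\beta X}C: C\in\mathrm{Coz}(X)\text{ and }\mathrm{cl}_XC\text{ has a null neighborhood in }X\}$, considered as a subspace of $\beta X$. An ideal $H$ of $C_b(X)$ is of empty hull if for every $x\in X$ there is $h\in H$ with $h(x)\neq0$. An algebra is unital if it has a multiplicative unit element. *)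

(* Defs.v *)
From HB Require Import structures.
From mathcomp Require Import all_boot all_order all_algebra.
From mathcomp Require Import all_classical all_reals all_analysis.

Set Implicit Arguments.
Unset Strict Implicit.
Unset Printing Implicit Defensive.

Import Order.TTheory GRing.Theory Num.Theory.
Import numFieldNormedType.Exports.

Local Open Scope classical_set_scope.
Local Open Scope ring_scope.

Definition homeomorphic (S T : topologicalType) : Prop :=
  exists (f : S -> T) (g : T -> S),
    [/\ cancel f g, cancel g f, continuous f & continuous g].

Section bounded_continuous.
Variables (R : realType) (X : topologicalType).

Definition bcont : {pred (X -> R)} :=
  mem [set f : X -> R | continuous f /\ bounded_fun f].

Lemma bcontP (f : X -> R) :
  f \in bcont <-> continuous f /\ exists M, forall x, `|f x| <= M.
Proof.
rewrite inE /=; split=> -[cf bf]; split => //.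
  by have [M _ fM] := pinfty_ex_gt0 bf; exists M => x; exact: fM.
have [M fM] := bf; exists M; split; first exact: num_real.
by move=> N /ltW MN x _; exact: le_trans (fM x) MN.
Qed.

Lemma bcont_subring : subring_closed bcont.
Proof.
split.
- by apply/bcontP; split; [exact: cst_continuous|exists 1 => x; rewrite normr1].
- move=> f g /bcontP[cf [M fM]] /bcontP[cg [N gN]]; apply/bcontP; split.
    by move=> x; apply: cvgB; [exact: cf|exact: cg].
  by exists (M + N) => x; apply: le_trans (ler_normB _ _) _; exact: lerD.
- move=> f g /bcontP[cf [M fM]] /bcontP[cg [N gN]]; apply/bcontP; split.
    by move=> x; apply: cvgM; [exact: cf|exact: cg].
  by exists (M * N) => x; rewrite normrM; exact: ler_pM.
Qed.

Lemma bcont_submod : submod_closed bcont.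
Proof.
have [b1 bB bM] := bcont_subring; split; first by rewrite -(subrr 1) bB.
move=> a f g bf bg.
have bN : - g \in bcont by rewrite -[- g]add0r -(subrr 1) bB ?bB.
have ba : (cst a : X -> R) \in bcont.
  by apply/bcontP; split; [exact: cst_continuous|exists `|a|].
by rewrite -[g]opprK; apply: bB => //; exact: (bM (cst a) f).
Qed.

HB.instance Definition _ := GRing.isSubringClosed.Build (X -> R) bcont
  bcont_subring.
HB.instance Definition _ := GRing.isSubmodClosed.Build R (X -> R) bcont
  bcont_submod.

(* [X] may be empty, in which case [Cb] is the zero algebra; hence the
   possibly trivial ring structure instead of [comAlgType], which would
   require [1 != 0]. *)
Record Cb := MkCb { cb_fun :> X -> R ; _ : cb_fun \in bcont }.

HB.instance Definition _ := [isSub for cb_fun].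
HB.instance Definition _ := [Choice of Cb by <:].
HB.instance Definition _ :=
  GRing.SubChoice_isSubComPzRing.Build (X -> R) bcont Cb bcont_subring.
HB.instance Definition _ := [SubZmodule_isSubLmodule of Cb by <:].

Lemma Cb_scalerAl (a : R) (f g : Cb) : a *: (f * g) = (a *: f) * g.
Proof. by apply: val_inj; apply/funext => x; exact: mulrA. Qed.

Definition sup_norm (f : Cb) : R := sup (range (fun x => `|f x|)).

Lemma Cb_bounded (f : Cb) : exists M, forall x, `|f x| <= M.
Proof. by case: f => f /= /bcontP[]. Qed.

Lemma Cb_continuous (f : Cb) : continuous f.
Proof. by case: f => f /= /bcontP[]. Qed.

Lemma le_sup_norm (f : Cb) (x : X) : `|f x| <= sup_norm f.
Proof.
have [M fM] := Cb_bounded f; apply: ub_le_sup; last by exists x.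
by exists M => _ [y _ <-].
Qed.

Lemma sup_norm_ge0 (f : Cb) : 0 <= sup_norm f.
Proof.
have [[x _]|X0] := pselect (exists x : X, True).
  exact: le_trans (le_sup_norm f x).
suff r0 : range (fun x => `|f x|) = set0 by rewrite /sup_norm r0 sup0.
by rewrite -subset0 => ? [x _ _]; apply: X0; exists x.
Qed.

Lemma sup_norm_le (f : Cb) (M : R) :
  0 <= M -> (forall x, `|f x| <= M) -> sup_norm f <= M.
Proof.
move=> M0 fM; have [[x _]|X0] := pselect (exists x : X, True).
  by apply: ge_sup => [|_ [y _ <-]//]; exists `|f x|, x.
suff r0 : range (fun x => `|f x|) = set0 by rewrite /sup_norm r0 sup0.
by rewrite -subset0 => ? [x _ _]; apply: X0; exists x.
Qed.

Lemma sup_normD (f g : Cb) : sup_norm (f + g) <= sup_norm f + sup_norm g.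
Proof.
apply: sup_norm_le => [|x]; first by rewrite addr_ge0 ?sup_norm_ge0.
by apply: le_trans (ler_normD _ _) _; rewrite lerD ?le_sup_norm.
Qed.

Lemma sup_normM (f g : Cb) : sup_norm (f * g) <= sup_norm f * sup_norm g.
Proof.
apply: sup_norm_le => [|x]; first by rewrite mulr_ge0 ?sup_norm_ge0.
by rewrite [X in `|X|]/(f x * g x) normrM ler_pM ?le_sup_norm.
Qed.

Let sup_normZ_le (a : R) (f : Cb) : sup_norm (a *: f) <= `|a| * sup_norm f.
Proof.
apply: sup_norm_le => [|x]; first by rewrite mulr_ge0 ?sup_norm_ge0.
by rewrite [X in `|X|]/(a * f x) normrM ler_wpM2l ?le_sup_norm.
Qed.

Lemma sup_normZ (a : R) (f : Cb) : sup_norm (a *: f) = `|a| * sup_norm f.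
Proof.
apply/eqP; rewrite eq_le sup_normZ_le /=.
have [->|a0] := eqVneq a 0; first by rewrite normr0 mul0r sup_norm_ge0.
rewrite -ler_pdivlMl ?normr_gt0// -normfV.
by apply: le_trans (sup_normZ_le _ _); rewrite scalerA mulVf// scale1r.
Qed.

Lemma sup_norm_eq0 (f : Cb) : sup_norm f = 0 -> f = 0.
Proof.
move=> f0; apply: val_inj; apply/funext => x; apply/eqP.
by rewrite -normr_le0 -f0 le_sup_norm.
Qed.

HB.instance Definition _ := Lmodule_isNormed.Build R Cb
  sup_normD sup_normZ sup_norm_eq0.

Lemma Cb_normE (f : Cb) : `|f| = sup (range (fun x => `|f x|)).
Proof. by []. Qed.

End bounded_continuous.
Arguments Cb : clear implicits.

Section subalgebras.
Context {R : realType} {X : topologicalType}.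
Implicit Types H : set (Cb R X).

(* A subset [H] of [Cb R X] is a Banach algebra for the operations and the
   norm of [Cb R X]; no unit is required. *)
Definition banach_algebra H : Prop :=
  [/\ submod_closed [in H], GRing.mulr_2closed [in H],
      {in H &, forall f g : Cb R X, `|f * g| <= `|f| * `|g|} &
      forall F : set_system (Cb R X), ProperFilter F -> F H -> cauchy F ->
        exists2 f, H f & F --> f].

Definition unital H : Prop :=
  exists2 u, H u & {in H, forall f : Cb R X, u * f = f /\ f * u = f}.

Definition Cb_ideal H : Prop :=
  submod_closed [in H] /\ forall f g, H g -> H (f * g).

Definition empty_hull H : Prop :=
  Cb_ideal H /\ forall x, exists2 h, H h & h x != 0.

End subalgebras.

Definition isometrically_isomorphic (R : realType) (X Y : topologicalType)
    (A : set (Cb R X)) (B : set (Cb R Y)) : Prop :=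
  exists phi : Cb R X -> Cb R Y,
    [/\ set_bij A B phi,
        {in A &, {morph phi : f g / f + g}},
        forall a, {in A, {morph phi : f / a *: f}},
        {in A &, {morph phi : f g / f * g}} &
        {in A, forall f : Cb R X, `|phi f| = `|f|}].

Definition C0 (R : realType) (Y : topologicalType) : set (Cb R Y) :=
  [set f | forall n, (0 < n)%N ->
     compact ((fun y => `|f y|) @^-1` `[n%:R^-1, +oo[)].
Arguments C0 : clear implicits.

Section stone_cech.
Variables (R : realType) (X : topologicalType).

(* The Stone-Cech compactification is realised as the closure of the image of
   [X] in the product [R ^ Cb R X] under evaluation; the lemmas below establish
   its characteristic properties. *)
Definition beta_eval (x : X) : {ptws Cb R X -> R} := fun f => f x.

Definition beta_set : set {ptws Cb R X -> R} := closure (range beta_eval).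

Definition beta : topologicalType := set_type beta_set.

Lemma beta_emb_subproof (x : X) : beta_eval x \in beta_set.
Proof. by apply/mem_set/subset_closure; exists x. Qed.

Definition beta_emb (x : X) : beta :=
  exist (fun p => p \in beta_set) (beta_eval x) (beta_emb_subproof x).

Lemma beta_emb_continuous : continuous beta_emb.
Proof.
move=> x U [? [[W oW <-] Wx] WU]; apply: (filterS WU) => {WU}.
have ev : beta_eval @ x --> beta_eval x.
  apply/cvg_sup => f A [? [[V oV <-] Vx] VU]; apply: (filterS VU).
  exact: Cb_continuous (open_nbhs_nbhs (conj oV Vx)).
exact: ev (open_nbhs_nbhs (conj oW Wx)).
Qed.

Lemma beta_emb_dense : dense (range beta_emb).
Proof.
move=> O [[p pB] Op] [V oV VO].
have pV : V p by move: Op; rewrite -VO.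
have /set_mem /(_ V (open_nbhs_nbhs (conj oV pV)))[_ [[x _ <-] Vx]] := pB.
by exists (beta_emb x); split; [rewrite -VO|exists x].
Qed.

Lemma beta_hausdorff : hausdorff_space beta.
Proof.
move=> p q pq; apply: val_inj; apply: (@hausdorff_product _ (fun=> R)) => [f|].
  exact: Rhausdorff.
move=> A B nA nB.
have [r [Ar Br]] := pq _ _ (@initial_continuous _ _ (set_val : beta -> _) _ _ nA)
  (@initial_continuous _ _ (set_val : beta -> _) _ _ nB).
by exists (set_val r).
Qed.

Lemma beta_compact : compact [set: beta].
Proof.
have cK : compact beta_set.
  pose K (f : Cb R X) : set R := `[- `|f|, `|f|]%classic.
  pose P := [set p : {ptws Cb R X -> R} | forall f, K f (p f)].
  have cP : compact P.
    apply: (@tychonoff _ (fun=> R) K) => f; exact: segment_compact.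
  apply: (subclosed_compact _ cP); first exact: closed_closure.
  have hT : hausdorff_space {ptws Cb R X -> R}.
    by apply: (@hausdorff_product _ (fun=> R)) => f; exact: Rhausdorff.
  rewrite ((closure_id P).1 (compact_closed hT cP)).
  apply: closureS => _ [x _ <-] f.
  by rewrite /K /= in_itv /= -ler_norml; exact: le_sup_norm.
move=> F PF _.
pose v : beta -> {ptws Cb R X -> R} := set_val.
have FK : F (v @^-1` beta_set).
  by apply: filterE => p; exact: (@set_valP _ beta_set p).
have [x [/mem_set Kx clx]] := cK (v @ F) (fmap_proper_filter v PF) FK.
exists (exist (fun p => p \in beta_set) x Kx); split => // A B FA [_ [[W oW <-] Wx] WB].
have FvA : F (v @^-1` (v @` A)) by apply: filterS FA; exact: preimage_image.
have [? [[a Aa <-] Wa]] := clx (v @` A) W FvA (open_nbhs_nbhs (conj oW Wx)).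
by exists a; split => //; exact: WB.
Qed.

Lemma beta_extend (f : Cb R X) :
  exists2 g : beta -> R, continuous g & forall x, g (beta_emb x) = f x.
Proof.
exists (fun p : beta => set_val p f) => // p.
pose v : beta -> {ptws Cb R X -> R} := set_val.
apply: (@continuous_comp _ _ _ v (@proj _ (fun=> R) f)).
  exact: initial_continuous.
exact: (@proj_continuous _ (fun=> R)).
Qed.

Lemma beta_embedding : completely_regular_space X -> hausdorff_space X ->
  injective beta_emb /\
  forall U, open U -> exists2 V, open V & U = beta_emb @^-1` V.
Proof.
move=> crX hX.
have sepX : separate_points_from_closed (fun f : Cb R X => f : X -> R).
  move=> U x cU nUx.
  have /(uniform_separatorP (R := R))[f [cf f01 f0 f1]] := crX x U cU nUx.
  have bf : f \in @bcont R X.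
    apply/bcontP; split => //; exists 1 => y.
    have /f01 : range f (f y) by exists y.
    by rewrite /= in_itv /= => /andP[f0y fy1]; rewrite ger0_norm.
  exists (MkCb bf) => /=.
  have -> : f x = 0 by apply: f0; exists x.
  move=> /(closureS f1).
  rewrite -(closure_id [set (1 : R)]).1 => [/= /eqP|].
    by rewrite eq_sym oner_eq0.
  exact: closed_eq.
have inj : set_inj [set: X] beta_eval.
  exact: (join_product_inj sepX (hausdorff_accessible hX)).
split => [x y /(congr1 val) xy|U]; first by apply: inj; rewrite ?inE.
rewrite (join_product_initial sepX (@Cb_continuous R X) inj) => -[V oV <-].
by exists (set_val @^-1` V) => //; exists V.
Qed.

End stone_cech.
Arguments beta : clear implicits.
Arguments beta_emb R {X}.

Section null.
Context {R : realType} {X : topologicalType}.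

Definition coz (f : X -> R) : set X := [set x | f x != 0].
Definition supp (f : X -> R) : set X := closure (coz f).

Definition Coz : set (set X) := [set coz f | f in [set f | continuous f]].

Definition coz_ideal (J : set (set X)) : Prop :=
  [/\ J !=set0, J `<=` Coz,
      forall A B, J A -> J B -> J (A `|` B) &
      forall A T, J A -> Coz T -> T `<=` A -> J T].

End null.
Arguments Coz : clear implicits.
Arguments coz_ideal R {X} J.

Section function_spaces.
Context (R : realType) {X : topologicalType}.
Variable J : set (set X).

Definition null_nbhd (A : set X) : Prop := exists2 U, J U & A `<=` U°.

Definition locally_null : Prop := forall x, null_nbhd [set x].

Definition C00I : set (Cb R X) := [set f | null_nbhd (supp f)].

Definition C0I : set (Cb R X) :=
  [set f | forall n, (0 < n)%N ->
     null_nbhd ((fun x => `|f x|) @^-1` `[n%:R^-1, +oo[)].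

Definition lambda : set (beta R X) :=
  \bigcup_(C in [set C | Coz R X C /\ null_nbhd (closure C)])
    (closure (beta_emb R @` C))°.

Definition lambda_space : topologicalType := set_type lambda.

(* The points of [lambda_space] that lie in the copy of [X] inside [beta]. *)
Definition lambda_X : set lambda_space := set_val @^-1` range (beta_emb R).

End function_spaces.
Arguments C00I R {X} J.
Arguments C0I R {X} J.
Arguments lambda R {X} J.
Arguments lambda_space R {X} J.
Arguments lambda_X R {X} J.

(* Main.v *)
Require Import Defs.
From HB Require Import structures.
From mathcomp Require Import all_boot all_order all_algebra.
From mathcomp Require Import all_classical all_reals all_analysis.
From mathcomp Require Import ring lra.
Import Order.TTheory GRing.Theory Num.Theory.
Import numFieldNormedType.Exports.
Local Open Scope classical_set_scope.
Local Open Scope ring_scope.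

Set Implicit Arguments.
Unset Strict Implicit.
Unset Printing Implicit Defensive.

(** Both function algebras of the theorem have the same shape: a bounded
    continuous [f] belongs to [C0I] when each set [{e <= |f|}] has a null
    neighbourhood, and to [C0] of a space when each such set lies in a
    compact set. Having a null neighbourhood and lying in a compact set are
    both ideals of subsets, and for every ideal [P] of subsets the functions
    whose sets [{e <= |f|}] satisfy [P] form a closed ideal of [Cb], hence a
    Banach algebra ([vanishing_ideal], [vanishing_banach]).

    Write [f^b] for the continuous extension of [f] to [beta X]. If the
    support of [f] has a null neighbourhood, then [C := coz f] is one of the
    cozero-sets defining [lambda], and density of [X] puts [{f^b != 0}]
    inside the interior of the closure of [C], so [f^b] vanishes off
    [lambda]. Truncating small values shows that [C00I] is dense in [C0I]
    ([C00I_approx]), so [f^b] vanishes off [lambda] for every [f] in [C0I]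
    ([C0I_beta_ext]). Complete regularity and local nullity give, at each
    point of [X], a member of [C0I] not vanishing there; hence [C0I] has
    empty hull and [X] is contained in [lambda], densely since it is dense
    in [beta X].

    The isometry [C0I -> C0(lambda)] is then restriction of [f^b] to
    [lambda] ([lambda_restr_isometry]). It lands in [C0] because [{e <=
    |f^b|}] is a closed subset of the compact space [beta X] contained in
    [lambda]. For surjectivity, [h] in [C0(lambda)] is the image of its
    restriction to [X], and that restriction is in [C0I] because the trace
    on [X] of a compact subset of [lambda] has a null neighbourhood
    ([null_nbhd_compact]): this holds locally on [lambda], by definition of
    [lambda], and it is preserved by finite unions.

    Uniqueness is the Banach-Stone theorem in its algebraic form: for a
    locally compact Hausdorff [Z], every nonzero multiplicative linear
    functional on [C0(Z)] is evaluation at a point ([C0_character]), so an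
    isomorphism [C0(Y) -> C0(Z)] is composition with a map [Z -> Y], which
    is continuous because cozero-sets of [C0] functions form a base
    ([C0_isometry_dual]).

    Finally, a unit of [C0I] must be the constant 1, which belongs to [C0I]
    exactly when [X] itself is null, and to [C0(lambda)] exactly when
    [lambda] is compact. *)

(** * Set ideals, compactness and density *)

(** The predicates to which this applies are having a null neighbourhood,
    lying in a compact set, and (in [C0_character]) being a set on which
    some nonnegative function of the kernel of a character is bounded away
    from 0. *)
Definition set_ideal {T : Type} (P : set T -> Prop) : Prop :=
  [/\ P set0, forall A B, A `<=` B -> P B -> P A &
      forall A B, P A -> P B -> P (A `|` B)].

(** The finite-subcover argument without a cover: if [P K] failed, the sets
    [A] for which [K] minus [A] satisfies [P] would form a proper filter on
    [K] without cluster point. *)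
Lemma compact_set_ideal (T : topologicalType) (P : set T -> Prop) (K : set T) :
  set_ideal P -> compact K -> (forall x, K x -> exists2 U, nbhs x U & P U) ->
  P K.
Proof.
move=> [P0 PS PU] cK locP; apply: contrapT => nPK.
(* The complements in [K] of the sets satisfying [P]. *)
pose F : set_system T := [set A | P (K `\` A)].
have FF : ProperFilter F.
  split; first by rewrite /F /= setD0.
  split; first by rewrite /F /= setDT.
  - by move=> A B PA PB; rewrite /F /= setDIr; exact: PU.
  - by move=> A B AB; apply: PS => x [Kx nBx]; split => // /AB.
have FK : F K by rewrite /F /= setDv.
have [x [Kx clx]] := cK F FF FK.
have [U xU PUU] := locP _ Kx.
have FU : F (~` U) by apply: PS PUU; rewrite setDE setCK; exact: subIsetr.
by have [y []] := clx _ _ FU xU.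
Qed.

Definition relcompact (T : topologicalType) (A : set T) : Prop :=
  exists2 K, compact K & A `<=` K.

Lemma relcompact_ideal (T : topologicalType) : set_ideal (@relcompact T).
Proof.
split=> [|A B AB [K cK BK]|A B [K cK AK] [L cL BL]].
- by exists set0 => //; exact: compact0.
- by exists K => //; exact: subset_trans BK.
- by exists (K `|` L); [exact: compactU|exact: setUSS].
Qed.

Lemma dense_closed (S T : topologicalType) (D : set S) (f : S -> T)
    (C : set T) :
  dense D -> continuous f -> closed C -> (forall x, D x -> C (f x)) ->
  forall x, C (f x).
Proof.
move=> dD cf cC DC x; apply: contrapT => nCx.
have [|y [nCy Dy]] := dD (f @^-1` (~` C)) (ex_intro _ x nCx).
  by apply: open_comp => [? _|]; [exact: cf|exact: closed_openC].
exact/nCy/DC.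
Qed.

Lemma dense_eq (R : realType) (S : topologicalType) (D : set S)
    (f g : S -> R) :
  dense D -> continuous f -> continuous g -> (forall x, D x -> f x = g x) ->
  f =1 g.
Proof.
move=> dD cf cg fg x; apply/eqP; rewrite -subr_eq0; apply/eqP.
apply: (@dense_closed _ _ D (fun x => f x - g x) [set 0]) => //.
- by move=> y; apply: cvgB; [exact: cf|exact: cg].
- by move=> y Dy /=; rewrite fg// subrr.
Qed.

Lemma set_val_continuous (T : topologicalType) (A : set T) :
  continuous (set_val : set_type A -> T).
Proof. exact: initial_continuous. Qed.

Lemma compact_set_val (T : topologicalType) (A K : set T) :
  K `<=` A -> compact K -> compact (set_val @^-1` K : set (set_type A)).
Proof.
move=> KA cK F FF FK.
pose v : set_type A -> T := set_val.
have [x [Kx clx]] := cK (v @ F) (fmap_proper_filter v FF) FK.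
exists (exist (fun p => p \in A) x (mem_set (KA _ Kx))); split => //.
move=> B C FB [_ [[W oW <-] Wx] WC].
have FvB : F (v @^-1` (v @` B)) by apply: filterS FB; exact: preimage_image.
have [? [[a Ba <-] Wa]] := clx (v @` B) W FvB (open_nbhs_nbhs (conj oW Wx)).
by exists a; split => //; exact: WC.
Qed.

Lemma set_type_hausdorff (T : topologicalType) (A : set T) :
  hausdorff_space T -> hausdorff_space (set_type A).
Proof.
move=> hT p q pq; apply: val_inj; apply: hT => B C nB nC.
have [r [Br Cr]] := pq _ _ (@set_val_continuous _ A _ _ nB)
  (@set_val_continuous _ A _ _ nC).
by exists (set_val r).
Qed.

(** A compact Hausdorff space is regular, so each point of an open set has a
    closed, hence compact, neighbourhood inside that open set. *)
Lemma open_locally_compact (T : topologicalType) (A : set T) :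
  hausdorff_space T -> compact [set: T] -> open A ->
  locally_compact [set: set_type A].
Proof.
move=> hT cT oA p _; pose v : set_type A -> T := set_val.
have nA : nbhs (v p) A by apply: open_nbhs_nbhs; split; [|exact: set_valP].
have [V pV VA] := @compact_regular _ (v p) _ hT cT filterT A nA.
have clT : compact (closure V).
  by apply: (subclosed_compact _ cT) => //; exact: closed_closure.
exists (v @^-1` closure V); last first.
  split; first exact: (compact_set_val VA clT).
  apply: preimage_closed; last exact: closed_closure.
  by move=> ? _; exact: set_val_continuous.
have nV : nbhs p (v @^-1` V) by exact: (@set_val_continuous _ A p _ pV).
by apply: filterS nV => q Vq _; exact: subset_closure.
Qed.

(** * Bounded functions that are small off the sets of an ideal *)

Section vanishing.
Variables (R : realType) (X : topologicalType).

Lemma Cb_of_bounded (f : X -> R) (M : R) :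
  continuous f -> (forall x, `|f x| <= M) -> exists h : Cb R X, h =1 f.
Proof.
move=> cf fM; have bf : f \in @bcont R X by apply/bcontP; split => //; exists M.
by exists (MkCb bf).
Qed.

Lemma Cb_ext (f g : Cb R X) : f =1 g -> f = g.
Proof. by move=> fg; apply: val_inj; exact/funext. Qed.

(** These equations hold by conversion; rewriting with them exposes the
    operations of [R] in place of those that [Cb] inherits from functions. *)
Lemma CbD (f g : Cb R X) x : (f + g) x = f x + g x. Proof. by []. Qed.

Lemma CbB (f g : Cb R X) x : (f - g) x = f x - g x. Proof. by []. Qed.

Lemma CbM (f g : Cb R X) x : (f * g) x = f x * g x. Proof. by []. Qed.

Lemma CbZ a (f : Cb R X) x : (a *: f) x = a * f x. Proof. by []. Qed.

Lemma Cb_norm_le (f : Cb R X) (M : R) :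
  0 <= M -> (forall x, `|f x| <= M) -> `|f| <= M.
Proof. exact: sup_norm_le. Qed.

Lemma le_Cb_norm (f : Cb R X) x : `|f x| <= `|f|.
Proof. exact: le_sup_norm. Qed.

Lemma le_Cb_dist (f g : Cb R X) x : `|f x - g x| <= `|f - g|.
Proof. exact: (le_Cb_norm (f - g)). Qed.

Definition vanishing (P : set X -> Prop) : set (Cb R X) :=
  [set f | forall e, 0 < e -> P [set x | e <= `|f x|]].

Variable P : set X -> Prop.
Hypothesis idP : set_ideal P.

Lemma vanishing_natP (f : Cb R X) :
  vanishing P f <->
  forall n, (0 < n)%N -> P ((fun x => `|f x|) @^-1` `[n%:R^-1, +oo[).
Proof.
have [_ PS _] := idP; split=> [Pf n n0|Pf e e0].
  have := Pf n%:R^-1; rewrite invr_gt0 ltr0n n0 => /(_ isT).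
  by apply: PS => x /=; rewrite in_itv /= andbT.
apply: (PS _ _ _ (Pf (Num.truncn e^-1).+1 _)) => // x /= ex.
rewrite in_itv /= andbT; apply: le_trans ex.
rewrite invf_ple ?posrE ?ltr0n//.
by apply: ltW; rewrite truncnS_gt.
Qed.

(** If [|f| <= M |g|], then [{e <= |f|}] is contained in [{e / (|M| + 1) <=
    |g|}]. *)
Lemma vanishing_le (f g : Cb R X) (M : R) :
  vanishing P g -> (forall x, `|f x| <= M * `|g x|) -> vanishing P f.
Proof.
have [_ PS _] := idP => Pg fMg e e0.
have M1 : 0 < `|M| + 1 by rewrite ltr_wpDl.
apply: PS (Pg (e / (`|M| + 1)) _); last by rewrite divr_gt0.
move=> x /= ex; rewrite ler_pdivrMr// mulrC; apply: (le_trans ex).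
apply: le_trans (fMg x) _; rewrite ler_wpM2r//.
by rewrite (le_trans (ler_norm M))// lerDl.
Qed.

Lemma vanishing_add (f g : Cb R X) :
  vanishing P f -> vanishing P g -> vanishing P (f + g).
Proof.
have [_ PS PU] := idP => Pf Pg e e0; have e2 : 0 < e / 2 by rewrite divr_gt0.
apply: PS (PU _ _ (Pf _ e2) (Pg _ e2)) => x /= ex.
have [fx|fx] := leP (e / 2) `|f x|; [by left|right => /=].
have := le_trans ex (ler_normD (f x) (g x)); lra.
Qed.

Lemma vanishing_mul (f g : Cb R X) : vanishing P g -> vanishing P (f * g).
Proof.
move=> Pg; apply: (vanishing_le (M := `|f|) Pg) => x.
by rewrite CbM normrM ler_wpM2r// le_Cb_norm.
Qed.

Lemma vanishing_scale a (f : Cb R X) : vanishing P f -> vanishing P (a *: f).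
Proof.
move=> Pf; apply: (vanishing_le (M := `|a|) Pf) => x.
by rewrite CbZ normrM.
Qed.

Lemma vanishing0 : vanishing P 0.
Proof.
have [P0 PS _] := idP => e e0; apply: PS P0 => x /=.
by rewrite [X in `|X|]/0 normr0 leNgt e0.
Qed.

Lemma vanishing_submod : submod_closed [in vanishing P].
Proof.
split=> [|a f g]; rewrite !inE; first exact: vanishing0.
by move=> Pf Pg; apply: vanishing_add => //; exact: vanishing_scale.
Qed.

Lemma vanishing_ideal : Cb_ideal (vanishing P).
Proof. by split; [exact: vanishing_submod|exact: vanishing_mul]. Qed.

Lemma vanishing_closed (f : Cb R X) :
  (forall e, 0 < e -> exists2 g, vanishing P g & `|f - g| <= e) ->
  vanishing P f.
Proof.
have [_ PS _] := idP => fP e e0; have e2 : 0 < e / 2 by rewrite divr_gt0.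
have [g Pg fg] := fP _ e2; apply: PS (Pg _ e2) => x /= ex.
have := le_trans (le_Cb_dist f g x) fg; rewrite distrC => gf.
have := lerB ex gf; rewrite {1}(splitr e) addrK => /le_trans; apply.
by rewrite lerBlDl -{1}(subrK (g x) (f x)) distrC ler_normD.
Qed.

(** The pointwise limit of a Cauchy filter is a uniform limit, and a uniform
    limit of bounded continuous functions is bounded and continuous. *)
Lemma Cb_complete (F : set_system (Cb R X)) :
  ProperFilter F -> cauchy F -> exists f : Cb R X, F --> f.
Proof.
move=> FF /cauchyP cF.
have {}cF e : 0 < e -> exists g : Cb R X, F [set h | `|g - h| < e].
  by move=> e0; have [g Fg] := cF e e0; exists g; rewrite -ball_normE in Fg.
have cvgx x : cvg ((fun f : Cb R X => f x) @ F).
  apply/cauchy_cvgP/cauchyP => e e0; have [g Fg] := cF e e0; exists (g x).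
  apply: (@filterS _ F) Fg => h; rewrite /= -ball_normE /=.
  exact: le_lt_trans (le_Cb_dist g h x).
pose f x := lim ((fun f : Cb R X => f x) @ F).
have fle e : 0 < e -> F [set g : Cb R X | forall x, `|f x - g x| <= e].
  move=> e0; have [|g Fg] := cF (e / 2); first by rewrite divr_gt0.
  have fg x : `|g x - f x| <= e / 2.
    have cl := @closed_ball_closed _ R (g x) (e / 2).
    have := closed_cvg _ cl _ _ (cvgx x).
    rewrite closed_ballE ?divr_gt0//; apply; apply: (@filterS _ F) Fg => h /ltW.
    exact: le_trans (le_Cb_dist g h x).
  apply: filterS Fg => h /ltW gh x; rewrite (splitr e).
  rewrite -(subrK (g x) (f x)) -addrA; apply: le_trans (ler_normD _ _) _.
  by rewrite distrC lerD// (le_trans _ gh)// le_Cb_dist.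
have cf : continuous f.
  move=> x; apply/cvgrPdist_le => e e0.
  have e3 : 0 < e / 3 by rewrite divr_gt0.
  have [g fg] := filter_ex (fle _ e3).
  have := @Cb_continuous _ _ g x => /cvgrPdist_le /(_ _ e3).
  apply: filterS => y gxy.
  rewrite (_ : f x - f y = (f x - g x) + (g x - g y) + (g y - f y));
    last by ring.
  rewrite (_ : e = e / 3 + e / 3 + e / 3); last by field.
  apply: le_trans (ler_normD _ _) _; apply: lerD; last by rewrite distrC.
  by apply: le_trans (ler_normD _ _) _; exact: lerD.
have [g fg] := filter_ex (fle _ ltr01).
have [h hf] : exists h : Cb R X, h =1 f.
  apply: (Cb_of_bounded (M := 1 + `|g|)) => // x.
  rewrite -(subrK (g x) (f x)); apply: le_trans (ler_normD _ _) _.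
  by apply: lerD => //; exact: le_Cb_norm.
exists h; apply/cvgrPdist_le => e e0; apply: filterS (fle _ e0) => k fk.
apply: Cb_norm_le => [|x]; first exact: ltW.
by rewrite CbB hf; exact: fk.
Qed.

Lemma vanishing_banach : banach_algebra (vanishing P).
Proof.
split.
- exact: vanishing_submod.
- by move=> f g; rewrite !inE => _; exact: vanishing_mul.
- by move=> f g _ _; exact: sup_normM.
- move=> F FF FP cF; have [f Ff] := Cb_complete FF cF; exists f => //.
  apply: vanishing_closed => e e0.
  have /cvgrPdist_le /(_ e e0) fe := Ff.
  have [g [Pg fg]] := filter_ex (filterI FP fe).
  by exists g.
Qed.

End vanishing.

Lemma completely_regular_bump (R : realType) (X : topologicalType) (x : X) U :
  completely_regular_space X -> nbhs x U ->
  exists2 f : Cb R X, f x = 1 & coz f `<=` U.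
Proof.
move=> Xcr xU; have cU : closed (~` U°).
  by apply: open_closedC; exact: open_interior.
have /(uniform_separatorP (R := R))[f [cf f01 f0 f1]] :=
  Xcr x _ cU (fun h => h xU).
have fx : f x = 0 by apply: f0; exists x.
have [||g gE] := @Cb_of_bounded R X (fun x => 1 - f x) 1.
- by move=> y; apply: cvgB; [exact: cvg_cst|exact: cf].
- move=> y; have /f01 : range f (f y) by exists y.
  by rewrite /= in_itv /= ler_norml => /andP[fy0 fy1]; apply/andP; split; lra.
exists g; first by rewrite gE fx subr0.
move=> y; rewrite /coz /= gE => gy; apply: contrapT => nUy; move: gy.
rewrite (f1 (f y)) ?subrr ?eqxx//; exists y => // /interior_subset.
exact: nUy.
Qed.

Lemma closed_norm_ge (R : realType) (X : topologicalType) (f : Cb R X) e :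
  closed [set x | e <= `|f x|].
Proof.
rewrite -[[set _ | _]]/((fun x => `|f x|) @^-1` [set r | e <= r]).
apply: preimage_closed; last exact: closed_ge.
move=> y _; apply: (continuous_comp _ (@norm_continuous _ R^o _)).
exact: Cb_continuous.
Qed.

(** In [C0] compactness of [{1/n <= |f|}] amounts to inclusion in a compact
    set, this set being closed. *)
Lemma C0_vanishing (R : realType) (Y : topologicalType) :
  C0 R Y = vanishing (@relcompact Y).
Proof.
apply/seteqP; split => f.
  move=> C0f; apply/(vanishing_natP (@relcompact_ideal Y)) => n /C0f cK.
  by eexists; first exact: cK.
move=> /(vanishing_natP (@relcompact_ideal Y)) Vf n /Vf [K cK fK].
apply: (subclosed_compact _ cK fK).
by rewrite set_itvcy; exact: closed_norm_ge.
Qed.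

(** * Nullity: the spaces C0I and C00I *)

Section null_vanishing.
Variables (R : realType) (X : topologicalType) (J : set (set X)).
Hypothesis Jideal : coz_ideal R J.

Lemma null_nbhd_ideal : set_ideal (null_nbhd J).
Proof.
have [[U JU] _ JD _] := Jideal.
split=> [|A B AB [V JV BV]|A B [V JV AV] [W JW BW]].
- by exists U.
- by exists V => //; exact: subset_trans BV.
- exists (V `|` W); first exact: JD.
  move=> x [/AV|/BW]; apply: filterS => y; [by left|by right].
Qed.

Lemma C0I_vanishing : C0I R J = vanishing (null_nbhd J).
Proof.
by apply/seteqP; split => f /(vanishing_natP null_nbhd_ideal).
Qed.

Lemma C00I_sub_C0I : C00I R J `<=` C0I R J.
Proof.
rewrite C0I_vanishing => f nf e e0; have [_ PS _] := null_nbhd_ideal.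
apply: PS nf => x /= ex; apply: subset_closure => /=.
by rewrite /coz /= -normr_gt0 (lt_le_trans e0).
Qed.

(** The function [g] is [f] minus its truncation to [[-e, e]]: it vanishes
    where [|f| <= e], so its support lies in the closed set [{e <= |f|}]. *)
Lemma C00I_approx (f : Cb R X) e :
  C0I R J f -> 0 < e -> exists2 g : Cb R X, C00I R J g & `|f - g| <= e.
Proof.
rewrite C0I_vanishing => Jf e0; have [_ PS _] := null_nbhd_ideal.
(* The truncation of [t] to the interval from [- e] to [e]. *)
pose clamp t : R := (`|t + e| - `|t - e|) / 2.
have clampE t : `|t| <= e -> clamp t = t.
  rewrite ler_norml => /andP[t1 t2]; rewrite /clamp ger0_norm ?ler0_norm; lra.
have clamp_le t : `|clamp t| <= e.
  rewrite /clamp ler_norml; have [t1|t1] := leP 0 (t + e);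
  have [t2|t2] := leP 0 (t - e);
  rewrite ?(ger0_norm t1) ?(ger0_norm t2) ?(ltr0_norm t1) ?(ltr0_norm t2);
  apply/andP; split; lra.
have cc : continuous clamp.
  move=> t; apply: cvgMl; apply: cvgB; apply: cvg_norm;
  by [apply: cvgD; [exact: cvg_id|exact: cvg_cst]|
      apply: cvgB; [exact: cvg_id|exact: cvg_cst]].
have [|x|g gE] := @Cb_of_bounded R X (fun x => f x - clamp (f x)) (`|f| + e).
- move=> x; apply: cvgB; first exact: Cb_continuous.
  by apply: (continuous_comp (@Cb_continuous _ _ f x)); exact: cc.
- by apply: le_trans (ler_normB _ _) _; rewrite lerD ?le_Cb_norm.
exists g; last first.
  apply: Cb_norm_le => [|x]; first exact: ltW.
  by rewrite CbB gE subKr.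
apply: PS (Jf _ e0).
rewrite [X in _ `<=` X]((closure_id _).1 (@closed_norm_ge _ _ f e)).
apply: closureS => x; rewrite /coz /= gE; apply: contraNT; rewrite -ltNge => fx.
by rewrite clampE ?subrr// ltW.
Qed.

Lemma C0I_sub_closure_C00I : C0I R J `<=` closure (C00I R J).
Proof.
move=> f Jf B /nbhs_ballP[e /= e0 fB].
have [|g Jg fg] := @C00I_approx f (e / 2) Jf; first by rewrite divr_gt0.
exists g; split => //; apply: fB; rewrite -ball_normE /=.
by rewrite (le_lt_trans fg)// ltr_pdivrMr// mulr_natr mulr2n ltrDl.
Qed.

Lemma C0I_nonvanishing x : completely_regular_space X -> locally_null J ->
  exists2 f : Cb R X, C0I R J f & f x != 0.
Proof.
move=> Xcr /(_ x)[U JU xU]; have {}xU : nbhs x U by exact: xU.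
have [f fx fU] := completely_regular_bump R Xcr (nbhs_interior xU).
exists f; last by rewrite fx oner_neq0.
rewrite C0I_vanishing => e e0; exists U => // y /= ey; apply: fU.
by rewrite /coz /= -normr_gt0 (lt_le_trans e0).
Qed.

(** Since no point of [X] is a common zero of [C0I], a unit equals 1
    everywhere, so that [X = {1 <= |1|}] must have a null neighbourhood. *)
Lemma unital_C0I : completely_regular_space X -> locally_null J ->
  unital (C0I R J) <-> J [set: X].
Proof.
move=> Xcr Jnull; split=> [[u Ju uP]|JX].
  have u1 x : u x = 1.
    have [f Jf fx] := C0I_nonvanishing x Xcr Jnull.
    have [/(congr1 (fun h : Cb R X => h x)) + _] := uP f (mem_set Jf).
    rewrite -[LHS]/(u x * f x) => /(congr1 (fun r => r / f x)).
    by rewrite mulfK// divff.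
  have [U JU UX] := Ju 1%N isT.
  suff -> : [set: X] = U by [].
  apply/seteqP; split=> x // _; apply: (@interior_subset _ U x); apply: UX.
  by rewrite /= in_itv /= u1 normr1 invr1 lexx.
exists 1; last by move=> f _; rewrite mul1r mulr1.
by move=> n n0; exists setT => //; rewrite interiorT.
Qed.

End null_vanishing.

(** * Isometric isomorphisms of function algebras *)

(** [isometrically_isomorphic] with the isomorphism made explicit, so that
    isomorphisms can be inverted and composed. *)
Definition algebra_isometry (R : realType) (X Y : topologicalType)
    (A : set (Cb R X)) (B : set (Cb R Y)) (phi : Cb R X -> Cb R Y) : Prop :=
  [/\ set_bij A B phi,
      {in A &, {morph phi : f g / f + g}},
      forall a, {in A, {morph phi : f / a *: f}},
      {in A &, {morph phi : f g / f * g}} &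
      {in A, forall f : Cb R X, `|phi f| = `|f|}].

Section isometries.
Variable R : realType.

(** Each value of the inverse is checked through the injectivity of [phi] on
    [A]; this is where [A] must be closed under the operations, which the
    morphism equations alone do not ensure. *)
Lemma algebra_isometryV (X Y : topologicalType) (A : set (Cb R X))
    (B : set (Cb R Y)) phi :
  submod_closed [in A] -> GRing.mulr_2closed [in A] ->
  algebra_isometry A B phi ->
  exists2 psi, algebra_isometry B A psi & {in A, cancel phi psi}.
Proof.
move=> [A0 Alin] Amul [[phiA phiI phiS] phiD phiZ phiM phiN].
have AD f g : A f -> A g -> A (f + g).
  by move=> Af Ag; have := Alin 1 f g; rewrite scale1r !inE; exact.
have AZ a f : A f -> A (a *: f).
  move=> Af; have := Alin a f 0; rewrite addr0 => h.
  by apply: set_mem; apply: h => //; exact: mem_set.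
have AM f g : A f -> A g -> A (f * g).
  by move=> Af Ag; have := Amul f g; rewrite !inE; exact.
have /choice[psi psiP] h : exists f, B h -> A f /\ phi f = h.
  have [Bh|nBh] := pselect (B h); last by exists 0.
  by have [f Af fh] := phiS h Bh; exists f.
have psiE h f : B h -> A f -> phi f = h -> psi h = f.
  move=> /psiP[Ah phih] Af fh.
  by apply: phiI; rewrite ?mem_set// phih fh.
exists psi; last first.
  by move=> f /set_mem Af; apply: psiE => //; exact: phiA.
split.
- split=> [h /psiP[]//|h k /set_mem/psiP[_ hE] /set_mem/psiP[_ kE] hk|f Af].
    by rewrite -hE hk.
  by exists (phi f); [exact: phiA|apply: psiE => //; exact: phiA].
- move=> h k /set_mem/psiP[Ah hE] /set_mem/psiP[Ak kE].
  have phihk : phi (psi h + psi k) = h + k by rewrite phiD ?mem_set// hE kE.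
  by apply: (psiE _ _ _ _ phihk); [rewrite -phihk; apply: phiA|]; exact: AD.
- move=> a h /set_mem/psiP[Ah hE].
  have phih : phi (a *: psi h) = a *: h by rewrite phiZ ?mem_set// hE.
  by apply: (psiE _ _ _ _ phih); [rewrite -phih; apply: phiA|]; exact: AZ.
- move=> h k /set_mem/psiP[Ah hE] /set_mem/psiP[Ak kE].
  have phihk : phi (psi h * psi k) = h * k by rewrite phiM ?mem_set// hE kE.
  by apply: (psiE _ _ _ _ phihk); [rewrite -phihk; apply: phiA|]; exact: AM.
- by move=> h /set_mem/psiP[Ah hE]; rewrite -{2}hE phiN ?mem_set.
Qed.

Lemma algebra_isometry_comp (X Y Z : topologicalType) (A : set (Cb R X))
    (B : set (Cb R Y)) (C : set (Cb R Z)) phi psi :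
  algebra_isometry A B phi -> algebra_isometry B C psi ->
  algebra_isometry A C (psi \o phi).
Proof.
move=> [phiB phiD phiZ phiM phiN] [psiB psiD psiZ psiM psiN].
have phiP f : f \in A -> phi f \in B.
  by have [+ _ _] := phiB => fun_phi /set_mem /fun_phi /mem_set.
split=> [|f g Af Ag|a f Af|f g Af Ag|f Af] /=.
- exact: set_bij_comp phiB psiB.
- by rewrite phiD// psiD ?phiP.
- by rewrite phiZ// psiZ ?phiP.
- by rewrite phiM// psiM ?phiP.
- by rewrite psiN ?phiP// phiN.
Qed.

End isometries.

(** * Extension to the Stone-Cech compactification *)

Section extension.
Variables (R : realType) (X : topologicalType).

Definition beta_ext (f : Cb R X) : beta R X -> R := fun p => set_val p f.

Lemma beta_ext_continuous f : continuous (beta_ext f).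
Proof.
move=> p; pose v : beta R X -> {ptws Cb R X -> R} := set_val.
apply: (@continuous_comp _ _ _ v (@proj _ (fun=> R) f)).
  exact: initial_continuous.
exact: (@proj_continuous _ (fun=> R)).
Qed.

Lemma beta_ext_emb f x : beta_ext f (beta_emb R x) = f x.
Proof. by []. Qed.

(** [{f^b != 0}] is open and [X] is dense in [beta], so this open set is
    contained in the closure of its trace on [X], which is [coz f]. *)
Lemma coz_beta_ext f :
  [set p | beta_ext f p != 0] `<=` (closure (beta_emb R @` coz f))°.
Proof.
have oO : open [set p | beta_ext f p != 0].
  rewrite -[[set _ | _]]/(beta_ext f @^-1` [set r | r != 0]).
  apply: open_comp; last exact: open_neq.
  by move=> ? _; exact: beta_ext_continuous.
rewrite -(open_subsetE _ oO) => p Op B pB.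
pose W := (B `&` [set p | beta_ext f p != 0])°.
have Wp : W p by apply: filterI => //; exact: open_nbhs_nbhs.
have [|q [Wq [x _ xq]]] := @beta_emb_dense R X W (ex_intro _ p Wp).
  exact: open_interior.
have [Bq fq] := interior_subset Wq.
by exists q; split => //; exists x => //; rewrite /coz /= -beta_ext_emb xq.
Qed.

Variable J : set (set X).
Hypothesis Xcr : completely_regular_space X.
Hypothesis XT2 : hausdorff_space X.
Hypothesis Jideal : coz_ideal R J.
Hypothesis Jnull : locally_null J.

Lemma C00I_beta_ext f p : C00I R J f -> beta_ext f p != 0 -> lambda R J p.
Proof.
move=> Jf fp; exists (coz f); last exact: (@coz_beta_ext f p fp).
by split => //; exists f => //; exact: Cb_continuous.
Qed.

Lemma beta_ext_dist f g p : `|beta_ext f p - beta_ext g p| <= `|f - g|.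
Proof.
apply: (@dense_closed _ _ _ (fun p => `|beta_ext f p - beta_ext g p|)
  [set r | r <= `|f - g|] (@beta_emb_dense R X)).
- move=> q; have cf := @beta_ext_continuous f q.
  by have cg := @beta_ext_continuous g q; exact: (cvg_norm (cvgB cf cg)).
- exact: closed_le.
- by move=> _ [x _ <-]; exact: le_Cb_dist.
Qed.

(** By density of [C00I]: approximate [f] to within half of [|f^b p|] by
    some [g] in [C00I]; then [g^b p] is still nonzero. *)
Lemma C0I_beta_ext f p : C0I R J f -> beta_ext f p != 0 -> lambda R J p.
Proof.
move=> Jf fp; have e0 : 0 < `|beta_ext f p| / 2 by rewrite divr_gt0 ?normr_gt0.
have [g Jg fg] := C00I_approx Jideal Jf e0.
apply: (C00I_beta_ext Jg); apply: contraTN fg => /eqP gp.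
rewrite -ltNge; apply: lt_le_trans (beta_ext_dist f g p).
by rewrite gp subr0 ltr_pdivrMr// mulr_natr mulr2n ltrDl normr_gt0.
Qed.

Lemma beta_emb_lambda : range (beta_emb R) `<=` lambda R J.
Proof.
move=> _ [x _ <-]; have [f Jf fx] := C0I_nonvanishing Jideal x Xcr Jnull.
exact: (@C0I_beta_ext f (beta_emb R x) Jf fx).
Qed.

Lemma lambda_open : open (lambda R J).
Proof. by apply: bigcup_open => C _; exact: open_interior. Qed.

(** Every open set of [X] is the trace of an open set of [beta X], because
    [X] is completely regular and Hausdorff. *)
Lemma closure_beta_emb (C : set X) x :
  closure (beta_emb R @` C) (beta_emb R x) -> closure C x.
Proof.
move=> clx B; rewrite nbhsE => -[U [oU Ux] UB].
have [_ /(_ U oU)[V oV UV]] := @beta_embedding R X Xcr XT2.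
have [|_ [[y Cy <-] Vy]] := clx V.
  by apply: open_nbhs_nbhs; split => //; rewrite UV in Ux.
by exists y; split => //; apply: UB; rewrite UV.
Qed.

Definition lambda_emb (x : X) : lambda_space R J :=
  exist (fun p => p \in lambda R J) (beta_emb R x)
    (mem_set (beta_emb_lambda (ex_intro2 _ _ x I erefl))).

Lemma lambda_emb_continuous : continuous lambda_emb.
Proof.
move=> x U [_ [[W oW <-] Wx] WU]; apply: (filterS WU).
exact: (@beta_emb_continuous R X x) (open_nbhs_nbhs (conj oW Wx)).
Qed.

Lemma lambda_X_dense : dense (lambda_X R J).
Proof.
move=> O [p Op] [W oW WO]; rewrite -WO in Op *.
have [q [Wq [x _ xq]]] := @beta_emb_dense R X W (ex_intro _ (set_val p) Op) oW.
by exists (lambda_emb x); split; [rewrite -xq in Wq|exists x].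
Qed.

Lemma lambda_XE : lambda_X R J = range lambda_emb.
Proof.
apply/seteqP; split=> [p [x _ xp]|_ [x _ <-]]; last by exists x.
by exists x => //; exact: val_inj.
Qed.

(** The link between compactness in [lambda] and nullity in [X]. Locally it
    is the definition of [lambda]: [p] lies in the interior of the closure
    of a cozero-set [C], and the trace of that interior on [X] is contained
    in the closure of [C] in [X], which has a null neighbourhood. *)
Lemma null_nbhd_compact (K : set (lambda_space R J)) :
  compact K -> null_nbhd J (lambda_emb @^-1` K).
Proof.
have [P0 PS PU] := null_nbhd_ideal Jideal => cK.
apply: (@compact_set_ideal _ (fun A => null_nbhd J (lambda_emb @^-1` A)) K _ cK)
  => [|p _].
  split=> [|A B AB|A B]; [exact: P0| |exact: PU].
  by apply: PS => x; exact: AB.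
have [C [CC nC] pC] := set_valP p.
exists (set_val @^-1` (closure (beta_emb R @` C))°).
  apply: open_nbhs_nbhs; split => //.
  exists (closure (beta_emb R @` C))° => //.
  exact: open_interior.
by apply: PS nC => x /interior_subset /closure_beta_emb.
Qed.

Lemma lambda_restr_subproof f :
  (fun p : lambda_space R J => beta_ext f (set_val p)) \in
    @bcont R (lambda_space R J).
Proof.
apply/bcontP; split.
  move=> p; apply: (continuous_comp (@set_val_continuous _ (lambda R J) p)).
  exact: beta_ext_continuous.
exists `|f| => p; have := beta_ext_dist f 0 (set_val p).
rewrite subr0 (_ : beta_ext 0 _ = 0) ?subr0//.
apply: (@dense_eq R _ _ (beta_ext 0) (cst 0) (@beta_emb_dense R X))
  => [| |_ [x _ <-]//].
  exact: beta_ext_continuous.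
exact: cst_continuous.
Qed.

Definition lambda_restr f : Cb R (lambda_space R J) :=
  MkCb (lambda_restr_subproof f).

Lemma lambda_restr_emb f x : lambda_restr f (lambda_emb x) = f x.
Proof. by []. Qed.

(** A bounded continuous function on [lambda] is determined by its values on
    [X]. This one principle yields both the surjectivity of [lambda_restr]
    and its compatibility with the algebra operations. *)
Lemma lambda_restr_uniq (f : Cb R X) (h : Cb R (lambda_space R J)) :
  (forall x, h (lambda_emb x) = f x) -> h = lambda_restr f.
Proof.
move=> hf; apply: Cb_ext; apply: (dense_eq lambda_X_dense).
- exact: Cb_continuous.
- exact: Cb_continuous.
- by rewrite lambda_XE => _ [x _ <-]; exact: hf.
Qed.

Lemma lambda_restr_C0 f :
  C0I R J f <-> C0 R (lambda_space R J) (lambda_restr f).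
Proof.
rewrite C0_vanishing; split=> [Jf e e0|Cf].
  exists [set p | e <= `|lambda_restr f p|] => //.
  rewrite -[[set _ | _]]/(set_val @^-1` [set p | e <= `|beta_ext f p|]).
  apply: compact_set_val => [p /= ep|].
    by apply: (C0I_beta_ext Jf); rewrite -normr_gt0 (lt_le_trans e0).
  apply: (subclosed_compact _ (@beta_compact R X)) => //.
  rewrite -[[set _ | _]]/((fun p => `|beta_ext f p|) @^-1` [set r | e <= r]).
  apply: preimage_closed; last exact: closed_ge.
  by move=> p _; exact: (cvg_norm (@beta_ext_continuous f p)).
have [_ PS _] := null_nbhd_ideal Jideal.
rewrite C0I_vanishing// => e /Cf[K cK fK].
by apply: PS (null_nbhd_compact cK) => x; exact: (fK (lambda_emb x)).
Qed.

Lemma lambda_restr_isometry :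
  algebra_isometry (C0I R J) (C0 R (lambda_space R J)) lambda_restr.
Proof.
split.
- split.
  + by move=> f /lambda_restr_C0.
  + move=> f g _ _ fg; apply: Cb_ext => x.
    by rewrite -!lambda_restr_emb fg.
  + move=> h Ch.
    have [|x|f fE] := @Cb_of_bounded R X (h \o lambda_emb) `|h|.
    * move=> x; apply: continuous_comp; first exact: lambda_emb_continuous.
      exact: Cb_continuous.
    * exact: le_Cb_norm.
    have hE : h = lambda_restr f by apply: lambda_restr_uniq => x; rewrite fE.
    by exists f => //; apply/lambda_restr_C0; rewrite -hE.
- by move=> f g _ _; apply/esym/lambda_restr_uniq.
- by move=> a f _; apply/esym/lambda_restr_uniq.
- by move=> f g _ _; apply/esym/lambda_restr_uniq.
- move=> f _; apply/eqP; rewrite eq_le; apply/andP; split; last first.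
    by apply: Cb_norm_le => // x; rewrite -lambda_restr_emb le_Cb_norm.
  apply: Cb_norm_le => //.
  apply: (dense_closed (f := fun p => `|lambda_restr f p|)
    (C := [set r | r <= `|f|]) lambda_X_dense).
  + by move=> p; exact: (cvg_norm (@Cb_continuous _ _ (lambda_restr f) p)).
  + exact: closed_le.
  + by rewrite lambda_XE => _ [x _ <-]; exact: (le_Cb_norm f x).
Qed.

(** If [X] is null, then the constant 1 is in [C0I], hence its restriction to
    [lambda] is in [C0]; if [lambda] is compact, then its trace [X] has a
    null neighbourhood. *)
Lemma compact_lambda : J [set: X] <-> compact [set: lambda_space R J].
Proof.
split=> [JX|cY].
  have /lambda_restr_C0 : C0I R J 1.
    by move=> n n0; exists setT => //; rewrite interiorT.
  rewrite -(lambda_restr_uniq (h := 1))// => /(_ 1%N isT).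
  congr compact; apply/seteqP; split => // p _.
  by rewrite /= in_itv /= normr1 invr1 lexx.
have [U JU UX] := null_nbhd_compact cY.
suff -> : [set: X] = U by [].
by apply/seteqP; split=> x // _; apply: (@interior_subset _ U x); exact: UX.
Qed.

End extension.

(** * The Banach-Stone theorem *)

Section C0_spaces.
Variable R : realType.
Implicit Types Y Z : topologicalType.

Lemma C0_submod Y : submod_closed [in C0 R Y].
Proof.
by rewrite C0_vanishing; exact: vanishing_submod (@relcompact_ideal Y).
Qed.

Lemma C0_mul Y (f g : Cb R Y) : C0 R Y g -> C0 R Y (f * g).
Proof.
by rewrite C0_vanishing; exact: vanishing_mul (@relcompact_ideal Y) _ _.
Qed.

Lemma C0_add Y (f g : Cb R Y) : C0 R Y f -> C0 R Y g -> C0 R Y (f + g).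
Proof.
by rewrite C0_vanishing; exact: vanishing_add (@relcompact_ideal Y) _ _.
Qed.

Lemma C0_scale Y a (f : Cb R Y) : C0 R Y f -> C0 R Y (a *: f).
Proof.
by rewrite C0_vanishing; exact: vanishing_scale (@relcompact_ideal Y) _ _.
Qed.

(** Locally compact Hausdorff spaces are completely regular; a function
    supported in a compact neighbourhood is in [C0]. *)
Lemma C0_bump Y (y : Y) (U : set Y) :
  locally_compact [set: Y] -> hausdorff_space Y -> nbhs y U ->
  exists f : Cb R Y, [/\ C0 R Y f, f y != 0 & coz f `<=` U].
Proof.
move=> lcY hY yU; have [K yK [cK _]] := lcY y I.
have Ycr := @locally_compact_completely_regular Y R lcY hY.
have {}yK : nbhs y K.
  by move: yK; rewrite /within /=; apply: filterS => z; apply.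
have [f fy fUK] := completely_regular_bump R Ycr (filterI yU yK).
exists f; split; [|by rewrite fy oner_neq0|by move=> z /fUK[]].
rewrite C0_vanishing => e e0; exists K => // z /= ez.
by have [] := fUK z; first by rewrite /coz /= -normr_gt0 (lt_le_trans e0).
Qed.

Definition character Z (chi : Cb R Z -> R) : Prop :=
  [/\ {in C0 R Z &, {morph chi : f g / f + g}},
      forall a, {in C0 R Z, forall f : Cb R Z, chi (a *: f) = a * chi f},
      {in C0 R Z &, {morph chi : f g / f * g}} &
      exists2 g, C0 R Z g & chi g = 1].

(** Suppose that [chi] is not an evaluation. Then its kernel has no common
    zero: if all of it vanished at [z], every [f] would satisfy [f z = chi f
    * g z] where [chi g = 1]; taking [f := g ^ 2] and some [f] nonzero at
    [z] gives [g z = 1] and [chi = ev_z]. By compactness some nonnegative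
    [f] in the kernel is bounded away from 0 on [{1/2 <= |g|}], so that [F
    := f + (1 - g) ^ 2] is bounded away from 0 everywhere and [k := g / F]
    is in [C0]. Formally [chi F = 0 + (1 - 1) ^ 2 = 0], and applying [chi]
    to [g = k * F] gives the contradiction [1 = 0]. As 1 need not belong to
    [C0], the product [k * F] is expanded into terms that do. *)
Lemma C0_character Z (chi : Cb R Z -> R) :
  (forall z, exists2 f : Cb R Z, C0 R Z f & f z != 0) ->
  character chi -> exists z, {in C0 R Z, forall f : Cb R Z, chi f = f z}.
Proof.
move=> nvan [chiD chiZ chiM [g Cg chig]]; apply: contrapT => nex.
have {}chiD f h : C0 R Z f -> C0 R Z h -> chi (f + h) = chi f + chi h.
  by move=> Cf Ch; apply: chiD; exact: mem_set.
have {}chiZ a f : C0 R Z f -> chi (a *: f) = a * chi f.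
  by move=> Cf; apply: chiZ; exact: mem_set.
have {}chiM f h : C0 R Z f -> C0 R Z h -> chi (f * h) = chi f * chi h.
  by move=> Cf Ch; apply: chiM; exact: mem_set.
have ker z : exists f : Cb R Z, [/\ C0 R Z f, chi f = 0 & f z != 0].
  apply: contrapT => nker.
  have ker0 f : C0 R Z f -> chi f = 0 -> f z = 0.
    move=> Cf f0; apply/eqP; apply: contrapT => /negP fz.
    by apply: nker; exists f.
  (* [f - chi f *: g] is in the kernel of [chi], so it vanishes at [z]. *)
  have evE f : C0 R Z f -> f z = chi f * g z.
    move=> Cf; have Ch : C0 R Z ((- chi f) *: g) by exact: C0_scale.
    have := ker0 (f + (- chi f) *: g) (C0_add Cf Ch).
    rewrite chiD// chiZ// chig mulr1 subrr CbD CbZ => /(_ erefl).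
    by move/eqP; rewrite mulNr subr_eq0 => /eqP.
  have := evE _ (C0_mul (f := g) Cg); rewrite chiM// chig mulr1 mul1r CbM => gg.
  have [f Cf fz] := nvan z.
  have gz : g z != 0.
    by apply: contraNneq fz => gz; rewrite (evE f)// gz mulr0.
  have gz1 : g z = 1 by apply: (mulfI gz); rewrite mulr1.
  by apply: nex; exists z => h /set_mem Ch; rewrite (evE h)// gz1 mulr1.
pose P (A : set Z) := exists f : Cb R Z,
  [/\ C0 R Z f, chi f = 0, forall x, 0 <= f x &
      exists2 d, 0 < d & forall x, A x -> d <= f x].
have idP : set_ideal P.
  split=> [|A B AB [f [Cf f0 fp [d d0 fd]]]|].
  - exists (0 *: g); split=> [| |x|]; first exact: C0_scale.
    + by rewrite chiZ// mul0r.
    + by rewrite CbZ mul0r.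
    + by exists 1.
  - by exists f; split => //; exists d => // x /AB; exact: fd.
  - move=> A B [f [Cf f0 fp [d d0 fd]]] [h [Ch h0 hp [c c0 hc]]].
    exists (f + h); split=> [| |x|]; first exact: C0_add.
    + by rewrite chiD// f0 h0 addr0.
    + by rewrite CbD addr_ge0.
    + exists (Num.min d c); first by rewrite lt_min d0 c0.
      move=> x [/fd|/hc] dx; rewrite CbD ge_min.
        by rewrite (le_trans dx) ?lerDl.
      by rewrite orbC (le_trans dx) ?lerDr.
have locP (z : Z) : exists2 U, nbhs z U & P U.
  have [f [Cf f0 fz]] := ker z; have fz0 : 0 < f z * f z / 2.
    by rewrite divr_gt0// -expr2 exprn_even_gt0.
  exists [set x | f z * f z / 2 <= (f * f) x].
    have : (f * f) x @[x --> z] --> (f * f) z by exact: Cb_continuous.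
    move=> /cvgrPdist_le /(_ _ fz0); apply: filterS => x; rewrite ler_norml.
    by rewrite !CbM => /andP[_]; rewrite /mkset CbM; lra.
  exists (f * f); split=> [| |x|]; first exact: C0_mul.
  - by rewrite chiM// f0 mulr0.
  - by rewrite CbM -expr2 sqr_ge0.
  - by exists (f z * f z / 2).
have [K cK gK] : relcompact [set z | 1 / 2 <= `|g z|].
  by move: Cg; rewrite C0_vanishing; apply; rewrite divr_gt0.
have [f [Cf f0 fp [d d0 fd]]] : P K by apply: compact_set_ideal.
(* On [{1/2 <= |g|}] the term [f] is at least [d]; elsewhere [(1 - g) ^ 2] is at
   least 1/4. *)
pose F z := f z + (1 - g z) ^+ 2; pose c := Num.min d (1 / 4).
have c0 : 0 < c by rewrite lt_min d0 divr_gt0.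
have Fc z : c <= F z.
  have [gz|gz] := leP (1 / 2) `|g z|.
    rewrite ge_min (le_trans (fd z _)) ?lerDl ?sqr_ge0//; exact: gK.
  rewrite ge_min orbC; apply/orP; left.
  move: gz; rewrite ltr_norml => /andP[g1 g2].
  by have := fp z; rewrite /F; nra.
have F0 z : F z != 0 by rewrite gt_eqF// (lt_le_trans c0).
have kle z : `|g z / F z| <= c^-1 * `|g z|.
  rewrite normrM mulrC ler_wpM2r// normfV lef_pV2 ?posrE ?normr_gt0//.
  by rewrite (le_trans (Fc z))// ler_norm.
have [|z|k kE] := @Cb_of_bounded R Z (fun z => g z / F z) (c^-1 * `|g|).
- move=> z; apply: cvgM; first exact: Cb_continuous.
  apply: cvgV => //; apply: cvgD; first exact: Cb_continuous.
  apply: cvgM; apply: cvgB; by [exact: cvg_cst|exact: Cb_continuous].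
- by apply: le_trans (kle z) _; rewrite ler_wpM2l ?le_Cb_norm// invr_ge0 ltW.
have Ck : C0 R Z k.
  rewrite C0_vanishing in Cg *.
  apply: (vanishing_le (@relcompact_ideal Z) (M := c^-1) Cg) => z.
  by rewrite kE.
(* [g = k * F] with the product [k * F] expanded. *)
have gE : g = k * f + k + (- 2) *: (k * g) + k * (g * g).
  apply: Cb_ext => z; rewrite !CbD CbZ !CbM kE.
  rewrite -[LHS](divfK (F0 z)) /F; ring.
have Ckf := C0_mul (f := k) Cf; have Ckg := C0_mul (f := k) Cg.
have Cgg := C0_mul (f := g) Cg; have Ckgg := C0_mul (f := k) Cgg.
have C2 := C0_scale (a := - 2) Ckg.
have /eqP := congr1 chi gE.
rewrite chiD ?chiD//; do ?apply: C0_add => //.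
rewrite chiZ// !chiM// f0 chig; apply/negP.
by rewrite !mulr1 mulr0 add0r (_ : _ + _ = 0) ?oner_eq0//; ring.
Qed.

(** The point [t z] is the one at which the character [f |-> phi f z]
    evaluates. If [f] is a bump function at [t z] inside [U], then [{phi f
    != 0}] is a neighbourhood of [z] that [t] maps into [U], whence the
    continuity of [t]. *)
Lemma C0_isometry_dual Y Z phi :
  locally_compact [set: Y] -> hausdorff_space Y ->
  locally_compact [set: Z] -> hausdorff_space Z ->
  algebra_isometry (C0 R Y) (C0 R Z) phi ->
  exists2 t : Z -> Y, continuous t &
    forall z, {in C0 R Y, forall f : Cb R Y, phi f z = f (t z)}.
Proof.
move=> lcY hY lcZ hZ [[phiC _ phiS] phiD phiZ phiM _].
have /choice[t tE] z : exists y, {in C0 R Y, forall f : Cb R Y, phi f z = f y}.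
  apply: (@C0_character Y (fun f => phi f z)).
    move=> y; have [f [Cf fy _]] := C0_bump lcY hY (@filterT _ (nbhs y) _).
    by exists f.
  split=> [f g Cf Cg|a f Cf|f g Cf Cg|]; rewrite ?phiD ?phiZ ?phiM//.
  have [h [/phiS[f Cf fh] hz _]] := C0_bump lcZ hZ (@filterT _ (nbhs z) _).
  exists ((h z)^-1 *: f); first exact: C0_scale.
  by rewrite phiZ ?mem_set// CbZ fh mulVf.
exists t => // z U /(C0_bump lcY hY)[f [Cf fz fU]].
have : nbhs z (phi f @^-1` [set r | r != 0]).
  apply: (@Cb_continuous _ _ (phi f) z).
  by apply: open_nbhs_nbhs; split; [exact: open_neq|rewrite /= tE ?mem_set].
by apply: filterS => x /=; rewrite tE ?mem_set//; exact: fU.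
Qed.

Lemma C0_separates Y (x y : Y) :
  locally_compact [set: Y] -> hausdorff_space Y ->
  {in C0 R Y, forall f : Cb R Y, f x = f y} -> x = y.
Proof.
move=> lcY hY fxy; apply: contrapT => /eqP xy.
have yx : nbhs x (~` [set y]).
  apply: open_nbhs_nbhs; split; last by move=> /= h; rewrite h eqxx in xy.
  apply: closed_openC.
  exact: accessible_closed_set1 (hausdorff_accessible hY) _.
have [f [Cf fx /(_ y)]] := C0_bump lcY hY yx.
by rewrite /coz /= -fxy ?mem_set// => /(_ fx).
Qed.

(** The maps dual to an isometry and to its inverse are inverse to each other,
    since [C0] functions separate points. *)
Lemma banach_stone Y Z phi :
  locally_compact [set: Y] -> hausdorff_space Y ->
  locally_compact [set: Z] -> hausdorff_space Z ->
  algebra_isometry (C0 R Y) (C0 R Z) phi -> homeomorphic Y Z.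
Proof.
move=> lcY hY lcZ hZ iso.
have [|psi osi phiK] := algebra_isometryV (@C0_submod Y) _ iso.
  by move=> f g; rewrite !inE => _; exact: C0_mul.
have [t ct tE] := C0_isometry_dual lcY hY lcZ hZ iso.
have [s cs sE] := C0_isometry_dual lcZ hZ lcY hY osi.
have [[phiC _ phiS] _ _ _ _] := iso.
exists s, t; split => // [y|z]; apply: C0_separates => //.
- move=> f Cf; rewrite -tE// -sE ?phiK//.
  by apply/mem_set/phiC/set_mem.
- move=> h /set_mem/phiS[f Cf <-]; rewrite [RHS]tE ?mem_set//.
  by rewrite -sE ?phiK ?mem_set//; exact: phiC.
Qed.

End C0_spaces.

(** * Representation of C0I *)

Theorem theorem3p11 (R : realType) (X : topologicalType) (J : set (set X))
    (Xcr : completely_regular_space X) (XT2 : hausdorff_space X)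
    (Jideal : coz_ideal R J) (Jnull : locally_null J) :
  let Y := lambda_space R J in
  [/\ banach_algebra (C0I R J),
      [/\ locally_compact [set: Y], hausdorff_space Y,
          isometrically_isomorphic (C0I R J) (C0 R Y) &
          forall Z : topologicalType,
            locally_compact [set: Z] -> hausdorff_space Z ->
            isometrically_isomorphic (C0I R J) (C0 R Z) ->
            homeomorphic Z Y] &
      [/\ range (beta_emb R) `<=` lambda R J /\ dense (lambda_X R J),
          empty_hull (C0I R J),
          C00I R J `<=` C0I R J /\ C0I R J `<=` closure (C00I R J),
          unital (C0I R J) <-> J [set: X] &
          J [set: X] <-> compact [set: Y]]].
Proof.
have lcY : locally_compact [set: lambda_space R J].
  by apply: open_locally_compact;
    [exact: beta_hausdorff|exact: beta_compact|exact: lambda_open].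
have hY : hausdorff_space (lambda_space R J).
  by apply: set_type_hausdorff; exact: beta_hausdorff.
have nullP := null_nbhd_ideal Jideal.
have iso := lambda_restr_isometry Xcr XT2 Jideal Jnull.
have banach : banach_algebra (C0I R J).
  by rewrite (C0I_vanishing Jideal); exact: vanishing_banach.
split=> //.
- split=> // [|Z lcZ hZ [phi phi_iso]]; first by exists (@lambda_restr R X J).
  have [Jsub Jmul _ _] := banach.
  have [psi psi_iso _] := algebra_isometryV Jsub Jmul phi_iso.
  exact: (banach_stone lcZ hZ lcY hY (algebra_isometry_comp psi_iso iso)).
- split.
  + split; first exact: beta_emb_lambda.
    exact: lambda_X_dense.
  + split; last by move=> x; exact: C0I_nonvanishing.
    by rewrite (C0I_vanishing Jideal); exact: vanishing_ideal.
  + by split; [exact: C00I_sub_C0I|exact: C0I_sub_closure_C00I].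
  + exact: unital_C0I.
  + exact: compact_lambda.
Qed.
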